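(* In the setting described in the context, fix $\eta=\delta+iy$ with $\delta\in(0,s_0)$ and let $F(\cdot,\cdot,\eta)$ be a classical solution on $[0,T]\times\Lambda$ of $$\partial_tF+\mu(\lambda)\partial_\lambda F+\lambda\int_0^\infty\big(e^{\eta x}F(t,\lambda+\beta x,\eta)-F(t,\lambda,\eta)\big)\tilde\nu(\lambda,dx)-rF=0,\qquad F(T,\lambda,\eta)\equiv1,$$ (values of $F$ at arguments outside $\Lambda$ being given by clamped extension). Let $(F^n)_{n=0}^N$ be produced by the IMEX scheme $AF^n=F^{n+1}+\Delta t\,N^\Delta_{\exp}[F^{n+1}]$, $n=N-1,\dots,0$, with $F^N_i=1$ for all $i$. Assume the explicit CFL condition $\Delta t\,L_{\exp}(\delta)\le c<1$. Define the local truncation residual by $$\tau^n_i:=\frac{F(t_{n+1},\lambda_i)-F(t_n,\lambda_i)}{\Delta t}-\frac{\big(A\,F(t_n,\cdot)\big)_i-F(t_n,\lambda_i)}{\Delta t}+\big(N^\Delta_{\exp}[F(t_{n+1},\cdot)]\big)_i,$$ and assume $\max_{0\le n\le N-1}\|\tau^n\|_{\infty,\Lambda}\le\bar\tau$. Then there exists $C_T<\infty$ depending only on $T$, $r$ and $L_{\exp}(\delta)$ such that for all $n=0,\dots,N$, $$\|F^n-F(t_n,\cdot,\eta)\|_{\infty,\Lambda}\le C_T\,\bar\tau.$$ In particular the scheme converges whenever $\bar\tau\to0$.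
   Context: Fix $T>0$, $r\ge0$, $\beta\ge0$, a drift $\mu:\mathbb R_+\to\mathbb R$, a compact interval $\Lambda=[\lambda_{\min},\lambda_{\max}]\subset[0,\infty)$ and a probability kernel $\tilde\nu(\lambda,dx)$ on $(0,\infty)$, with $s_0>0$ such that $\sup_{\lambda\in\Lambda}\int_0^\infty e^{sx}\tilde\nu(\lambda,dx)<\infty$ for all $s\in[0,s_0)$. Grid: $\lambda_i=\lambda_{\min}+ih$, $i=0,\dots,I$, $\lambda_I=\lambda_{\max}$; $\Delta t=T/N$, $t_n=n\Delta t$. $\mu_i=\mu(\lambda_i)$, $\mu_i^\pm$ its positive/negative parts ($\mu_i^-=\min(\mu_i,0)$). $A$ is the tridiagonal matrix $A=I-\Delta t L^\Delta_{\rm imp}$ with $A_{i,i}=1+\Delta t\big(\frac{\mu_i^+-\mu_i^-}{h}+r\big)$, $A_{i,i-1}=\Delta t\mu_i^-/h$ ($i\ge1$), $A_{i,i+1}=-\Delta t\mu_i^+/h$ ($i\le I-1$), so that $-(AV-V)/\Delta t$ is the upwind discretisation of $\mu\partial_\lambda V-rV$. For a grid vector $V$, $\Pi_{\Delta\lambda}[V]$ is the PCHIP (Fritsch–Carlson) interpolant on $\Lambda$ extended to $[0,\infty)$ by clamping; $(N^\Delta_{\exp}[V])_i=\lambda_i\big(\int_0^\infty e^{\eta x}\Pi_{\Delta\lambda}[V](\lambda_i+\beta x)\tilde\nu(\lambda_i,dx)-V_i\big)$. $\|V\|_{\infty,\Lambda}=\max_i|V_i|$; $L_{\exp}(\delta)=\sup_i\lambda_i\big(\int_0^\infty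 e^{\delta x}\tilde\nu(\lambda_i,dx)+1\big)$. *)

(* Defs.v *)
From HB Require Import structures.
From mathcomp Require Import all_boot all_order all_algebra.
From mathcomp Require Import all_classical all_reals all_analysis.
From mathcomp Require Import complex.

Set Implicit Arguments.
Unset Strict Implicit.
Unset Printing Implicit Defensive.

Import Order.TTheory GRing.Theory Num.Theory.
Local Open Scope classical_set_scope.
Local Open Scope ring_scope.
Local Open Scope complex_scope.

Section PilotDefs.
Variable R : realType.
Local Notation C := R[i].

Definition cre (z : C) : R := complex.Re z.
Definition cim (z : C) : R := complex.Im z.

Definition cnorm (z : C) : R := Normc.normc z.

Definition cexp (z : C) : C :=
  ((expR (cre z) * cos (cim z)) +i* (expR (cre z) * sin (cim z)))%C.

Definition clamp (a b x : R) : R := Num.max a (Num.min b x).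

Definition grid (lmin h : R) (i : nat) : R := lmin + i%:R * h.

(* ---------- PCHIP (Fritsch--Carlson / Fritsch--Butland monotone cubic
   Hermite interpolation, as in MATLAB pchip / SciPy PchipInterpolator),
   on the uniform grid lmin + k h, k = 0..I, for real data V_0..V_I. ---- *)

Definition secant (h : R) (V : nat -> R) (k : nat) : R := (V k.+1 - V k) / h.

(* one-sided three-point end slope (uniform grid), with the
   monotonicity-preserving corrections *)
Definition pchip_edge (m0 m1 : R) : R :=
  let d := (3 * m0 - m1) / 2 in
  if Num.sg d != Num.sg m0 then 0
  else if (Num.sg m0 != Num.sg m1) && (3 * `|m0| < `|d|) then 3 * m0
  else d.

Definition pchip_slope (I : nat) (h : R) (V : nat -> R) (k : nat) : R :=
  if I == 1%N then secant h V 0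
  else if k == 0%N then pchip_edge (secant h V 0) (secant h V 1)
  else if k == I then pchip_edge (secant h V I.-1) (secant h V I.-2)
  else
    let a := secant h V k.-1 in
    let b := secant h V k in
    if a * b <= 0 then 0 else 2 * a * b / (a + b).

Definition pchip (lmin h : R) (I : nat) (V : nat -> R) (x : R) : R :=
  let z := clamp lmin (lmin + I%:R * h) x in
  let k := minn (Num.truncn ((z - lmin) / h)) I.-1 in
  let t := (z - grid lmin h k) / h in
  V k * (2 * t ^+ 3 - 3 * t ^+ 2 + 1)
  + h * pchip_slope I h V k * (t ^+ 3 - 2 * t ^+ 2 + t)
  + V k.+1 * (3 * t ^+ 2 - 2 * t ^+ 3)
  + h * pchip_slope I h V k.+1 * (t ^+ 3 - t ^+ 2).

Definition pchipC (lmin h : R) (I : nat) (V : nat -> C) (x : R) : C :=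
  ((pchip lmin h I (fun k => cre (V k)) x)
     +i* (pchip lmin h I (fun k => cim (V k)) x))%C.

Definition Cintegral (mu : {measure set R -> \bar R}) (D : set R)
  (f : R -> C) : C :=
  ((Rintegral mu D (fun x => cre (f x)))
     +i* (Rintegral mu D (fun x => cim (f x))))%C.

Definition normInf (I : nat) (V : nat -> C) : R :=
  \big[Num.max/0]_(i < I.+1) cnorm (V i).

(* entries of the tridiagonal matrix A = I - dt L_imp (rows/columns 0..I) *)
Definition Aent (mu : R -> R) (r dt lmin h : R) (i j : nat) : R :=
  let m := mu (grid lmin h i) in
  let mp := Num.max m 0 in
  let mm := Num.min m 0 in
  if j == i then 1 + dt * ((mp - mm) / h + r)
  else if j.+1 == i then dt * mm / h
  else if j == i.+1 then - (dt * mp / h)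
  else 0.

Definition Aapply (mu : R -> R) (r dt lmin h : R) (I : nat) (V : nat -> C)
  (i : nat) : C :=
  \sum_(j < I.+1) (Aent mu r dt lmin h i j)%:C * V j.

Definition Nexp (nu : R.-pker R ~> R) (beta : R) (eta : C) (lmin h : R)
  (I : nat) (V : nat -> C) (i : nat) : C :=
  let li := grid lmin h i in
  li%:C * (Cintegral (nu li) `]0, +oo[
             (fun x => cexp (eta * x%:C) * pchipC lmin h I V (li + beta * x))
           - V i).

Definition Lexp (nu : R.-pker R ~> R) (lmin h : R) (I : nat) (delta : R) : R :=
  \big[Num.max/0]_(i < I.+1)
    (grid lmin h i *
       (fine (\int[nu (grid lmin h i)]_(x in `]0, +oo[) (expR (delta * x))%:E)
        + 1)).

Definition tau (mu : R -> R) (nu : R.-pker R ~> R) (r beta : R) (eta : C)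
  (dt lmin h : R) (I : nat) (F : R -> R -> C) (n i : nat) : C :=
  let Fn := fun j => F (n%:R * dt) (grid lmin h j) in
  let Fn1 := fun j => F (n.+1%:R * dt) (grid lmin h j) in
  (Fn1 i - Fn i) / dt%:C
  - (Aapply mu r dt lmin h I Fn i - Fn i) / dt%:C
  + Nexp nu beta eta lmin h I Fn1 i.

Definition has_deriv_within (S : set R) (g : R -> C) (t : R) (g' : C) : Prop :=
  forall e : R, 0 < e -> exists2 d : R, 0 < d &
    forall s, S s -> s != t -> `|s - t| < d ->
      cnorm ((g s - g t) / (s - t)%:C - g') < e.

Definition cont_on_rect (T lmin lmax : R) (G : R -> R -> C) : Prop :=
  forall t l, 0 <= t <= T -> lmin <= l <= lmax ->
  forall e : R, 0 < e -> exists2 d : R, 0 < d &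
    forall t' l', 0 <= t' <= T -> lmin <= l' <= lmax ->
      `|t' - t| < d -> `|l' - l| < d -> cnorm (G t' l' - G t l) < e.

Definition classical_solution (T r beta : R) (mu : R -> R)
  (nu : R.-pker R ~> R) (lmin lmax : R) (eta : C) (F : R -> R -> C) : Prop :=
  exists Ft Fl : R -> R -> C,
  [/\ cont_on_rect T lmin lmax F,
      cont_on_rect T lmin lmax Ft &
      cont_on_rect T lmin lmax Fl] /\ [/\
      (forall t l, 0 <= t <= T -> lmin <= l <= lmax ->
         has_deriv_within [set s | 0 <= s <= T] (fun s => F s l) t (Ft t l)
         /\ has_deriv_within [set m | lmin <= m <= lmax] (fun m => F t m) l (Fl t l)),
      (forall t l, 0 <= t <= T -> lmin <= l <= lmax ->
         Ft t l + (mu l)%:C * Fl t l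
         + l%:C * (Cintegral (nu l) `]0, +oo[
                     (fun x => cexp (eta * x%:C) * F t (clamp lmin lmax (l + beta * x)))
                   - F t l)
         - r%:C * F t l = 0) &
      (forall l, lmin <= l <= lmax -> F T l = 1)].

End PilotDefs.

(* Main.v *)
(** The error [e^n = F^n - F(t_n)] satisfies
    [A e^n = e^(n+1) + dt (N[F^(n+1)] - N[F(t_(n+1))]) + dt tau^n].
    Row-wise diagonal dominance of [A], with excess at least [1], gives
    [||e|| <= ||A e||].  PCHIP is nonlinear in the data, but its slopes are
    Lipschitz functions of the secants (a harmonic mean in the interior, a
    clamped linear function at the ends), so interpolation is 3-Lipschitz for
    the sup norm on real data; splitting into real and imaginary parts makes
    [N] Lipschitz with constant [12 L_exp(delta)].  A discrete Gronwall
    argument then yields [C_T = T exp(12 L_exp(delta) T)]. *)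

From Pilot Require Import Defs.
From HB Require Import structures.
From mathcomp Require Import all_boot all_order all_algebra.
From mathcomp Require Import all_classical all_reals all_analysis.
From mathcomp Require Import complex.
From mathcomp Require Import ring lra measurable_realfun.

Set Implicit Arguments.
Unset Strict Implicit.
Unset Printing Implicit Defensive.

Import Order.TTheory GRing.Theory Num.Theory.
Local Open Scope classical_set_scope.
Local Open Scope ring_scope.
Local Open Scope complex_scope.

(** * Lipschitz bounds for the limited slopes *)

Definition hmean (R : realType) (a b : R) : R :=
  if a * b <= 0 then 0 else 2 * a * b / (a + b).

Lemma hmeanC (R : realType) (a b : R) : hmean a b = hmean b a.
Proof. by rewrite /hmean (mulrC a) (addrC a) (mulrAC 2). Qed.

(** [hmean] is the interior branch of [pchip_slope]. The constant 2 is the extreme weight of a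
    harmonic mean: where [a] and [b] share a strict sign, the partial derivative in [a] is
    [2 * (b / (a + b)) ^+ 2], and the truncation to 0 is continuous. *)
Lemma hmean_lipschitzl (R : realType) (a a' b : R) :
  `|hmean a b - hmean a' b| <= 2 * `|a - a'|.
Proof.
(* Truncation active on one side only: [b / (u + b)] lies in [0, 1], so the mean is at most
   [2 * |u|] in modulus, and [v] lies across zero from [u] or at zero, so [|u| <= |u - v|]. *)
have bound (u v : R) : 0 < u * b -> v * b <= 0 ->
    `|2 * u * b / (u + b)| <= 2 * `|u - v|.
  move=> ub vb.
  have ub0 : 0 < (u + b) * b by nra.
  have sb0 : u + b != 0 by apply: contraTneq ub0 => ->; rewrite mul0r ltxx.
  have b0 : b != 0 by apply: contraTneq ub0 => ->; rewrite mulr0 ltxx.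
  have -> : 2 * u * b / (u + b) = 2 * (b / (u + b)) * u by field.
  have -> : b / (u + b) = b ^+ 2 / ((u + b) * b).
    by field; rewrite b0 sb0.
  have r0 : 0 <= b ^+ 2 / ((u + b) * b) by rewrite divr_ge0 ?sqr_ge0// ltW.
  have r1 : b ^+ 2 / ((u + b) * b) <= 1 by rewrite ler_pdivrMr// mul1r; nra.
  rewrite 2!normrM (ger0_norm r0) ger0_norm// -mulrA ler_wpM2l//.
  apply: (@le_trans _ _ `|u|); first by rewrite ler_piMl.
  rewrite ler_normr; have [bp|bn|b00] := ltrgt0P b; last by rewrite b00 eqxx in b0.
    rewrite pmulr_lgt0// in ub; rewrite pmulr_lle0// in vb.
    by rewrite gtr0_norm// lerDl oppr_ge0 vb.
  rewrite nmulr_lgt0// in ub; rewrite nmulr_lle0// in vb.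
  by rewrite ltr0_norm// opprB lerDr vb orbT.
rewrite /hmean.
have [ab|ab] := lerP (a * b) 0; have [a'b|a'b] := lerP (a' * b) 0.
- by rewrite subrr normr0 mulr_ge0.
- by rewrite sub0r normrN (distrC a); exact: bound.
- by rewrite subr0; exact: bound.
- have ub0 : 0 < (a + b) * b by nra.
  have ub0' : 0 < (a' + b) * b by nra.
  have sb0 : a + b != 0 by apply: contraTneq ub0 => ->; rewrite mul0r ltxx.
  have sb0' : a' + b != 0 by apply: contraTneq ub0' => ->; rewrite mul0r ltxx.
  (* No truncation on either side: the difference quotient is explicit, and its factor is at most 1
     because [(a + b) * (a' + b) - b ^+ 2 = a * a' + a * b + a' * b] is a sum of nonnegative
     terms. *)
  have -> : 2 * a * b / (a + b) - 2 * a' * b / (a' + b)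
     = 2 * (b ^+ 2 / ((a + b) * (a' + b))) * (a - a').
    by field; rewrite sb0 sb0'.
  have s0 : 0 < (a + b) * (a' + b).
    have : 0 < ((a + b) * b) * ((a' + b) * b) by rewrite mulr_gt0.
    have -> : ((a + b) * b) * ((a' + b) * b) = (a + b) * (a' + b) * b ^+ 2 by ring.
    have b2 : 0 < b ^+ 2.
      by rewrite exprn_even_gt0//=; apply: contraTneq ub0 => ->; rewrite mulr0 ltxx.
    by rewrite pmulr_lgt0.
  have r0 : 0 <= b ^+ 2 / ((a + b) * (a' + b)).
    by rewrite divr_ge0 ?sqr_ge0// ltW.
  have r1 : b ^+ 2 / ((a + b) * (a' + b)) <= 1.
    rewrite ler_pdivrMr// mul1r.
    have : 0 <= a * a'; last by nra.
    have [p|p|p] := ltrgt0P b; nra.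
  by rewrite 2!normrM (ger0_norm r0) ger0_norm// -mulrA ler_wpM2l// ler_piMl.
Qed.

Lemma hmean_lipschitz (R : realType) (a b a' b' : R) :
  `|hmean a b - hmean a' b'| <= 2 * `|a - a'| + 2 * `|b - b'|.
Proof.
rewrite -[_ - _](subrKA (hmean a' b)) (le_trans (ler_normD _ _))//.
by rewrite lerD ?hmean_lipschitzl// !(hmeanC a') hmean_lipschitzl.
Qed.

Lemma ler_dist_max (R : realType) (a b a' b' e : R) :
  `|a - a'| <= e -> `|b - b'| <= e -> `|Num.max a b - Num.max a' b'| <= e.
Proof.
rewrite !ler_norml => /andP[? ?] /andP[? ?].
by rewrite !maxEle; case: (lerP a b) => ?; case: (lerP a' b') => ?; apply/andP; split; lra.
Qed.

Lemma ler_dist_min (R : realType) (a b a' b' e : R) :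
  `|a - a'| <= e -> `|b - b'| <= e -> `|Num.min a b - Num.min a' b'| <= e.
Proof.
rewrite !ler_norml => /andP[? ?] /andP[? ?].
by rewrite !minEle; case: (lerP a b) => ?; case: (lerP a' b') => ?; apply/andP; split; lra.
Qed.

(** The sign tests amount to clamping the three-point slope to the interval between 0 and [3 * m0].
    The guard on the sign of [m1] changes nothing: if [m1] has the sign of [m0], the slope cannot
    pass [3 * m0]. In this form continuity is visible. *)
Lemma pchip_edgeE (R : realType) (m0 m1 : R) :
  pchip_edge m0 m1 =
  Num.max (Num.min ((3 * m0 - m1) / 2) (Num.max (3 * m0) 0))
          (Num.min (3 * m0) 0).
Proof.
rewrite /pchip_edge /=; set d := (3 * m0 - m1) / 2.
have dE : d = (3 * m0 - m1) / 2 by [].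
move: d dE => d dE; have [m0p|m0n|m00] := ltrgt0P m0.
- rewrite (gtr0_sg m0p) (max_l (x := 3 * m0)); last lra.
  rewrite (min_r (x := 3 * m0)); last lra.
  rewrite (eq_sym 1) !sgr_cp0.
  have [d0|d0] /= := ltrP 0 d; last first.
    by rewrite min_l ?max_r//; lra.
  rewrite gtr0_norm//; have [m10|m10] /= := ltrP 0 m1.
    by rewrite min_l ?max_l//; lra.
  by have [d3|d3] /= := ltrP (3 * m0) d; rewrite ?max_l//; lra.
- rewrite (ltr0_sg m0n) (max_r (x := 3 * m0)); last lra.
  rewrite (min_l (x := 3 * m0)); last lra.
  rewrite (eq_sym (-1)) !sgr_cp0.
  have [d0|d0] /= := ltrP d 0; last first.
    by rewrite max_l//; lra.
  rewrite ltr0_norm//.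
  have [m10|m10] /= := ltrP m1 0.
    by rewrite max_l//; lra.
  have [d3|d3] /= := ltrP (3 * - m0) (- d); first by rewrite max_r//; lra.
  by rewrite max_l//; lra.
- rewrite m00 sgr0 mulr0 maxxx minxx sgr_cp0.
  have [d0|d0] /= := eqVneq d 0; last first.
    by rewrite max_r// ge_min lexx orbT.
  by rewrite d0 minxx maxxx; case: ifP.
Qed.

(** Max and min are nonexpansive for the sup norm of their arguments, so the worst argument decides:
    [3 * m0] has constant 3, while the three-point slope has only 3/2 and 1/2. *)
Lemma pchip_edge_lipschitz (R : realType) (a b a' b' : R) :
  `|pchip_edge a b - pchip_edge a' b'| <= 3 * `|a - a'| + `|b - b'|.
Proof.
have b0 : 0 <= `|b - b'| by [].
have a0 : 0 <= `|a - a'| by [].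
have le3 : `|3 * a - 3 * a'| <= 3 * `|a - a'| + `|b - b'|.
  by rewrite -mulrBr normrM ger0_norm// lerDl.
rewrite !pchip_edgeE ler_dist_max// ?ler_dist_min// ?ler_dist_max//
  ?subrr ?normr0 ?addr_ge0 ?mulr_ge0//.
have := ler_norm (a - a'); have := ler_norm (a' - a).
have := ler_norm (b - b'); have := ler_norm (b' - b).
by rewrite (distrC b') (distrC a') ler_norml => ? ? ? ?; apply/andP; split; lra.
Qed.

(** * Sup-norm Lipschitz bound for the interpolant *)

Section PchipLipschitz.
Context {R : realType}.
Variables (lmin h : R) (I : nat).
Hypotheses (h0 : 0 < h) (I0 : (0 < I)%N).

Section TwoData.
Variables (V W : nat -> R) (e : R).
Hypothesis VW : forall k, (k <= I)%N -> `|V k - W k| <= e.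

Let e0 : 0 <= e. Proof. exact: le_trans (VW (leq0n _)). Qed.

Lemma secant_lipschitz k : (k < I)%N ->
  `|secant h V k - secant h W k| <= 2 * e / h.
Proof.
move=> kI; rewrite /secant -mulrBl normrM (ger0_norm (x := h^-1)) ?invr_ge0 ?(ltW h0)//.
rewrite ler_pM2r ?invr_gt0//.
have -> : V k.+1 - V k - (W k.+1 - W k) = (V k.+1 - W k.+1) - (V k - W k) by ring.
by rewrite (le_trans (ler_normB _ _))// mulr2n mulrDl mul1r lerD// VW// ltnW.
Qed.

(** Each secant moves by at most [2 * e / h]. An end slope then moves by [3 * 2 + 2 = 8] units of
    [e / h], an interior one by [2 * 2 + 2 * 2 = 8], and the single secant of a one-cell grid by
    2. *)
Lemma pchip_slope_lipschitz k : (k <= I)%N ->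
  `|h * pchip_slope I h V k - h * pchip_slope I h W k| <= 8 * e.
Proof.
move=> kI; rewrite -mulrBr normrM gtr0_norm// mulrC -ler_pdivlMr//.
have eh : 0 <= e / h by rewrite divr_ge0// ltW.
have S j : (j < I)%N -> `|secant h V j - secant h W j| <= 2 * (e / h).
  by move=> jI; rewrite mulrA; exact: secant_lipschitz.
rewrite -mulrA /pchip_slope.
have [I1|I1] := eqVneq I 1%N.
  by apply: le_trans (S 0%N I0) _; lra.
have I2 : (1 < I)%N by rewrite ltn_neqAle eq_sym I1.
have [k0|k0] := eqVneq k 0%N.
  apply: le_trans (pchip_edge_lipschitz _ _ _ _) _.
  by have := S 0%N I0; have := S 1%N I2; lra.
have [kEI|kNI] := eqVneq k I.
  apply: le_trans (pchip_edge_lipschitz _ _ _ _) _.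
  have := S I.-1; rewrite ltn_predL => /(_ I0).
  have := S I.-2; rewrite -[in X in (X < I)%N](subn2) ltn_subrL I0 => /(_ isT).
  by lra.
have ltkI : (k < I)%N by rewrite ltn_neqAle kNI.
apply: le_trans (hmean_lipschitz _ _ _ _) _.
have := S k ltkI; have := S k.-1 (leq_ltn_trans (leq_pred _) ltkI).
by lra.
Qed.

(** The two value weights of the cubic Hermite basis are nonnegative and sum to 1; the two slope
    weights have moduli summing to [t * (1 - t) <= 1/4]. With slope error [8 * e] this gives
    [e + 2 * e]. *)
Lemma pchip_lipschitz x :
  `|pchip lmin h I V x - pchip lmin h I W x| <= 3 * e.
Proof.
rewrite /pchip; set z := clamp _ _ _; set k := minn _ _.
have Ih0 : 0 <= I%:R * h by rewrite mulr_ge0// ltW.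
have zmin : lmin <= z by rewrite /z /clamp le_max lexx.
have zmax : z <= lmin + I%:R * h by rewrite /z /clamp ge_max ge_min lexx lerDl Ih0.
set u := (z - lmin) / h.
have u0 : 0 <= u by rewrite divr_ge0 ?subr_ge0// ltW.
have uI : u <= I%:R by rewrite ler_pdivrMr// lerBlDl.
have kI : (k < I)%N by rewrite (leq_ltn_trans (geq_minr _ _))// ltn_predL.
have -> : (z - grid lmin h k) / h = u - k%:R.
  by rewrite /u /grid; field; rewrite gt_eqF.
have t0 : 0 <= u - k%:R.
  rewrite subr_ge0 (@le_trans _ _ (Num.truncn u)%:R)// ?truncn_le//.
  by rewrite ler_nat; exact: geq_minl.
have t1 : u - k%:R <= 1.
  (* At the right end point the truncation would give cell [I]; it is capped at [I.-1], and [t] is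
     still at most 1 because [u <= I]. *)
  rewrite lerBlDl natr1 /k; have [H|H] := leqP (Num.truncn ((z - lmin) / h)) I.-1.
    by rewrite ltW// truncnS_gt.
  by rewrite prednK.
move: (u - k%:R) t0 t1 => t t0 t1.
have := pchip_slope_lipschitz (ltnW kI); have := pchip_slope_lipschitz kI.
have := VW (ltnW kI); have := VW kI.
set s := h * pchip_slope I h V k; set s1 := h * pchip_slope I h V k.+1.
set r := h * pchip_slope I h W k; set r1 := h * pchip_slope I h W k.+1.
move=> v1 v0 d1 d0.
have -> : V k * (2 * t ^+ 3 - 3 * t ^+ 2 + 1) + s * (t ^+ 3 - 2 * t ^+ 2 + t)
    + V k.+1 * (3 * t ^+ 2 - 2 * t ^+ 3) + s1 * (t ^+ 3 - t ^+ 2) -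
    (W k * (2 * t ^+ 3 - 3 * t ^+ 2 + 1) + r * (t ^+ 3 - 2 * t ^+ 2 + t)
    + W k.+1 * (3 * t ^+ 2 - 2 * t ^+ 3) + r1 * (t ^+ 3 - t ^+ 2))
  = (V k - W k) * ((1 - t) ^+ 2 * (1 + 2 * t))
    + (s - r) * (t * (1 - t) ^+ 2)
    + (V k.+1 - W k.+1) * (t ^+ 2 * (3 - 2 * t))
    - (s1 - r1) * (t ^+ 2 * (1 - t)) by ring.
have ot : 0 <= 1 - t by rewrite subr_ge0.
(* The last summand is the slack [2 * e - 8 * e * t * (1 - t)], written as a square. *)
have -> : 3 * e = e * ((1 - t) ^+ 2 * (1 + 2 * t)) + 8 * e * (t * (1 - t) ^+ 2)
   + e * (t ^+ 2 * (3 - 2 * t)) + 8 * e * (t ^+ 2 * (1 - t))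
   + 2 * e * (1 - 2 * t) ^+ 2 by ring.
have nM (a b c : R) : `|a| <= c -> 0 <= b -> `|a * b| <= c * b.
  by move=> ac b0; rewrite normrM (ger0_norm b0) ler_wpM2r.
rewrite (le_trans (ler_normB _ _))//.
apply: (@le_trans _ _ (e * ((1 - t) ^+ 2 * (1 + 2 * t)) + 8 * e * (t * (1 - t) ^+ 2)
   + e * (t ^+ 2 * (3 - 2 * t)) + 8 * e * (t ^+ 2 * (1 - t)))).
  rewrite lerD//; last by rewrite nM// mulr_ge0// sqr_ge0.
  rewrite (le_trans (ler_normD _ _))// lerD//; last first.
    by rewrite nM// mulr_ge0// ?sqr_ge0//; lra.
  rewrite (le_trans (ler_normD _ _))// lerD//.
    by rewrite nM// mulr_ge0// ?sqr_ge0//; lra.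
  by rewrite nM// mulr_ge0// ?sqr_ge0.
by rewrite lerDl mulr_ge0 ?sqr_ge0// mulr_ge0.
Qed.

End TwoData.
End PchipLipschitz.

(** * Complex modulus and the grid maximum norm *)

Section ComplexNorm.
Context {R : realType}.
Implicit Types z w : R[i].

Lemma cnormD z w : cnorm (z + w) <= cnorm z + cnorm w.
Proof. exact: le_normcD. Qed.

Lemma cnormM z w : cnorm (z * w) = cnorm z * cnorm w.
Proof. exact: Normc.normcM. Qed.

Lemma cnorm_ge0 z : 0 <= cnorm z.
Proof. by case: z => a b; exact: sqrtr_ge0. Qed.

Lemma cnorm_real (x : R) : cnorm x%:C = `|x|.
Proof. by rewrite /cnorm /Normc.normc /= expr0n addr0 sqrtr_sqr. Qed.

Lemma cnorm0 : cnorm (0 : R[i]) = 0.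
Proof. exact: Normc.normc0. Qed.

Lemma cnormN z : cnorm (- z) = cnorm z.
Proof. exact: normcN. Qed.

Lemma cnorm_sum n (f : 'I_n -> R[i]) (P : pred 'I_n) :
  cnorm (\sum_(j < n | P j) f j) <= \sum_(j < n | P j) cnorm (f j).
Proof.
elim/big_ind2: _ => [|z a w b za wb|//]; first by rewrite cnorm0.
by rewrite (le_trans (cnormD _ _))// lerD.
Qed.

Lemma ler_cre_cnorm z : `|cre z| <= cnorm z.
Proof.
case: z => a b; rewrite /cnorm /= -sqrtr_sqr ler_wsqrtr// lerDl; exact: sqr_ge0.
Qed.

Lemma ler_cim_cnorm z : `|cim z| <= cnorm z.
Proof.
case: z => a b; rewrite /cnorm /= -sqrtr_sqr ler_wsqrtr// lerDr; exact: sqr_ge0.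
Qed.

Lemma cnorm_le_crecim z : cnorm z <= `|cre z| + `|cim z|.
Proof.
case: z => a b; rewrite -[leRHS]ger0_norm ?addr_ge0// -sqrtr_sqr ler_wsqrtr//=.
rewrite sqrrD !real_normK ?num_real// -addrA lerD2l lerDr.
by rewrite mulrn_wge0// mulr_ge0.
Qed.

End ComplexNorm.

Lemma normInf_ge0 (R : realType) I (V : nat -> R[i]) : 0 <= normInf I V.
Proof. exact: bigmax_ge_id. Qed.

Lemma cnorm_le_normInf (R : realType) I (V : nat -> R[i]) i :
  (i <= I)%N -> cnorm (V i) <= normInf I V.
Proof.
by move=> iI; have := @le_bigmax _ _ _ 0 (fun i : 'I_I.+1 => cnorm (V i)) (Ordinal (iI : (i < I.+1)%N)).
Qed.

Lemma normInf_le (R : realType) I (V : nat -> R[i]) e : 0 <= e ->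
  (forall i, (i <= I)%N -> cnorm (V i) <= e) -> normInf I V <= e.
Proof. by move=> e0 Ve; apply: bigmax_le => // i _; apply/Ve/(ltn_ord i). Qed.

Lemma normInf_attained (R : realType) I (V : nat -> R[i]) :
  exists2 i, (i <= I)%N & normInf I V = cnorm (V i).
Proof.
rewrite /normInf (@bigmax_eq_arg _ _ _ _ ord0)//; last by move=> i _; exact: cnorm_ge0.
by move: [arg max_(i > ord0) _]%O => i; exists i => //; exact: ltn_ord i.
Qed.

(** * Stability of the implicit step *)

Lemma sum_ord_delta_le (R : realType) n m (a : R) : 0 <= a ->
  \sum_(j < n) (if (j : nat) == m then a else 0) <= a.
Proof.
move=> a0; rewrite -big_mkcond /=.
have [mn|nm] := ltnP m n.
  by rewrite (big_pred1 (Ordinal mn)).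
by rewrite big1// => j /eqP jm; have := ltn_ord j; rewrite jm ltnNge nm.
Qed.

Section ImplicitStep.
Context {R : realType}.
Variables (mu : R -> R) (r dt lmin h : R) (I : nat).
Hypotheses (r0 : 0 <= r) (dt0 : 0 < dt) (h0 : 0 < h).
Let A := Aapply mu r dt lmin h I.

Lemma AapplyB (V W : nat -> R[i]) i : A (fun j => V j - W j) i = A V i - A W i.
Proof. by rewrite /A /Aapply -sumrB; apply: eq_bigr => j _; rewrite mulrBr. Qed.

(** Upwinding makes the off-diagonal moduli [- (dt * mm / h)] and [dt * mp / h], whose sum is
    exactly the transport part of the diagonal entry; what remains there is [1 + dt * r]. *)
Lemma Aent_offdiag_sum (i : 'I_I.+1) :
  1 + \sum_(j < I.+1 | j != i) `|Aent mu r dt lmin h i j|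
  <= Aent mu r dt lmin h i i.
Proof.
rewrite /Aent /= eqxx.
set m := mu _; set mp := Num.max m 0; set mm := Num.min m 0.
have mp0 : 0 <= dt * mp / h by rewrite divr_ge0 ?mulr_ge0 ?(ltW dt0) ?(ltW h0)// le_max lexx orbT.
have mm0 : 0 <= - (dt * mm / h).
  rewrite -mulNr -mulrN divr_ge0 ?mulr_ge0 ?(ltW dt0) ?(ltW h0)// oppr_ge0 ge_min lexx orbT //.
apply: (@le_trans _ _ (1 + (- (dt * mm / h) + dt * mp / h))); last first.
  have : 0 <= dt * r by rewrite mulr_ge0// ltW.
  have -> : dt * ((mp - mm) / h + r) = dt * mp / h - dt * mm / h + dt * r by ring.
  by lra.
rewrite lerD2l.
(* Only an inequality holds: in the last row [i.+1] leaves the range, and in row 0 the index [i.-1]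
   collapses to [i], giving a nonnegative diagonal term that is then dropped. *)
apply: (@le_trans _ _ (\sum_(j < I.+1)
   ((if (j : nat) == i.-1 then - (dt * mm / h) else 0)
    + (if (j : nat) == i.+1 then dt * mp / h else 0)))); last first.
  by rewrite big_split lerD// sum_ord_delta_le.
rewrite [leRHS](bigID (fun j => j != i)) /= -[leLHS]addr0 lerD//; last first.
  by apply: sumr_ge0 => j _; rewrite addr_ge0//; case: ifP.
apply: ler_sum => j ji; rewrite -val_eqE /= in ji; rewrite (negbTE ji).
case: (eqVneq (j : nat).+1 i) => [<-|j1i] /=.
  rewrite eqxx -normrN ger0_norm// lerDl; by case: ifP.
case: (eqVneq (j : nat) i.+1) => [->|ji1] /=.
  by rewrite normrN ger0_norm// lerDr; case: ifP.
by rewrite normr0 addr0; case: ifP.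
Qed.

(** Discrete maximum principle: in the row where [|V i|] is maximal, the off-diagonal part takes
    away at most [(a i i - 1)] times the norm. *)
Lemma normInf_Aapply (V : nat -> R[i]) : normInf I V <= normInf I (A V).
Proof.
have [i iI Vi] := normInf_attained I V.
have iI1 : (i < I.+1)%N by [].
apply: le_trans (cnorm_le_normInf (A V) iI).
set a := Aent mu r dt lmin h.
have dom := Aent_offdiag_sum (Ordinal iI1).
rewrite /A /Aapply (bigD1 (Ordinal iI1)) //= -/a.
set S := \sum_(j < I.+1 | _) _.
have aii0 : 0 <= a i i.
  apply: le_trans dom; rewrite addr_ge0// sumr_ge0//.
have leS : cnorm S <= (\sum_(j < I.+1 | j != Ordinal iI1) `|a i j|) * normInf I V.
  rewrite (le_trans (cnorm_sum _ _))// mulr_suml; apply: ler_sum => j _.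
  by rewrite cnormM cnorm_real ler_wpM2l// cnorm_le_normInf// -ltnS ltn_ord.
have : cnorm ((a i i)%:C * V i) <= cnorm ((a i i)%:C * V i + S) + cnorm S.
  by rewrite -[X in cnorm X <= _](addrK S) (le_trans (cnormD _ _))// cnormN.
rewrite cnormM cnorm_real ger0_norm// -Vi.
have N0 := normInf_ge0 I V.
rewrite /= -/a in dom.
have := ler_wpM2r N0 dom; rewrite mulrDl mul1r; lra.
Qed.

End ImplicitStep.

(** * Discrete Gronwall inequality, run backwards from the terminal index *)

Lemma discrete_gronwall (R : realType) (E : nat -> R) (q b : R) (N : nat) :
  1 <= q -> 0 <= b -> E N <= 0 ->
  (forall n, (n < N)%N -> E n <= q * E n.+1 + b) ->
  forall m, (m <= N)%N -> E (N - m)%N <= m%:R * b * q ^+ m.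
Proof.
move=> q1 b0 EN0 step; elim=> [_|m ih mN]; first by rewrite subn0 !mul0r.
have mN' : (N - m.+1 < N)%N by rewrite ltn_subrL/= (leq_ltn_trans _ mN).
apply: le_trans (step _ mN') _; rewrite subnSK//.
have q0 : 0 <= q by rewrite (le_trans _ q1).
have := ler_wpM2l q0 (ih (ltnW mN)).
(* Inflating the new source term to [b * q ^+ m.+1] keeps the bound in the closed form
   [m * b * q ^+ m] instead of a geometric sum. *)
have : b <= b * q ^+ m.+1 by rewrite ler_peMr// exprn_ege1.
rewrite -natr1 exprS => ? ?.
have -> : (m%:R + 1) * b * (q * q ^+ m) = q * (m%:R * b * q ^+ m) + b * (q * q ^+ m) by ring.
lra.
Qed.

(** * Measurability and boundedness of the interpolant *)

Lemma truncn_measurable (R : realType) :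
  measurable_fun [set: R] (fun x : R => Num.truncn x : nat).
Proof.
have mR : measurable_fun [set: R] (fun x : R => (Num.truncn x)%:R : R).
  by apply: nondecreasing_measurable => // x y xy; rewrite ler_nat le_truncn.
move=> _ Y _; rewrite setTI.
(* The real-valued truncation is monotone, hence measurable, and the image of [Y] in the reals is
   countable, hence a measurable set. *)
have -> : (fun x : R => Num.truncn x) @^-1` Y =
    setT `&` (fun x : R => (Num.truncn x)%:R : R) @^-1` ((fun k => k%:R : R) @` Y).
  rewrite setTI; apply/seteqP; split => [x Yx|x [k Yk /eqP]] /=; first by exists (Num.truncn x).
  by rewrite eqr_nat => /eqP <-.
apply: mR => //; apply: countable_measurable; first exact: measurable_set1.
apply: (card_le_trans (card_image_le _ _)); exact: countableP.
Qed.

Lemma minn_measurable d (T : measurableType d) (f : T -> nat) (m : nat) :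
  measurable_fun setT f -> measurable_fun setT (fun x => minn (f x) m).
Proof. by move=> mf; exact: (measurableT_comp (f := fun k => minn k m)). Qed.

Section PchipMeasurable.
Context {R : realType}.
Variables (lmin h : R) (I : nat) (V : nat -> R).

(** The interpolant is a cubic in the local coordinate whose coefficients depend only on the cell
    index; any function of a measurable natural-number index is measurable. *)
Lemma pchip_measurable : measurable_fun [set: R] (pchip lmin h I V).
Proof.
have mz : measurable_fun [set: R] (clamp lmin (lmin + I%:R * h)).
  by apply: measurable_maxr => //; exact: measurable_minr.
pose k x := minn (Num.truncn ((clamp lmin (lmin + I%:R * h) x - lmin) / h)) I.-1.
have mk : measurable_fun [set: R] k.
  have mu : measurable_fun [set: R]
      (fun x => (clamp lmin (lmin + I%:R * h) x - lmin) / h).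
    by apply: measurable_funM => //; exact: measurable_funB.
  exact: minn_measurable (measurableT_comp (@truncn_measurable R) mu).
have mkg (g : nat -> R) : measurable_fun [set: R] (g \o k).
  exact: measurableT_comp.
have mt : measurable_fun [set: R]
    (fun x => (clamp lmin (lmin + I%:R * h) x - grid lmin h (k x)) / h).
  apply: measurable_funM => //; apply: measurable_funB => //.
  exact: (mkg (grid lmin h)).
rewrite /pchip.
apply: measurable_funD; [apply: measurable_funD; [apply: measurable_funD|]|].
- apply: measurable_funM; first exact: (mkg V).
  apply: measurable_funD => //; apply: measurable_funB;
    by apply: measurable_funM => //; exact: measurable_funX.
- apply: measurable_funM; first exact: (mkg (fun j => h * pchip_slope I h V j)).
  apply: measurable_funD => //; apply: measurable_funB; first exact: measurable_funX.
  by apply: measurable_funM => //; exact: measurable_funX.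
- apply: measurable_funM; first exact: (mkg (fun j => V j.+1)).
  apply: measurable_funB;
    by apply: measurable_funM => //; exact: measurable_funX.
- apply: measurable_funM; first exact: (mkg (fun j => h * pchip_slope I h V j.+1)).
  by apply: measurable_funB; exact: measurable_funX.
Qed.

Lemma pchip_bounded : (0 < I)%N -> 0 < h ->
  exists M : R, forall x, `|pchip lmin h I V x| <= M.
Proof.
move=> I0 h0; pose M := \big[Num.max/0]_(i < I.+1) `|V i|.
exists (3 * M) => x.
(* Zero data have zero interpolant, so the Lipschitz bound against them is a bound on the
   interpolant itself. *)
have p0 : pchip lmin h I (fun=> 0) x = 0.
  have s0 j : pchip_slope I h (fun=> 0) j = 0.
    by rewrite /pchip_slope /secant /pchip_edge subrr !mul0r lexx mulr0 subrr
      mul0r eqxx /= !if_same.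
  by rewrite /pchip !s0 !mulr0 !mul0r !addr0.
have := @pchip_lipschitz R lmin h I h0 I0 V (fun=> 0) M _ x; rewrite p0 subr0; apply.
move=> k kI; rewrite subr0.
exact: (@le_bigmax _ _ _ 0 (fun i : 'I_I.+1 => `|V i|) (Ordinal (kI : (k < I.+1)%N))).
Qed.

End PchipMeasurable.

(** * Integrals dominated by the exponential moment *)

Section ExponentialIntegral.
Context {R : realType}.
Variables (nu : {measure set R -> \bar R}) (delta y M : R).
Let D := [set` `]0%R, +oo[] : set R.
Let mD : measurable D. Proof. exact: measurable_itv. Qed.
Hypothesis intM : (\int[nu]_(x in D) (expR (delta * x))%:E <= M%:E)%E.
Let eta : R[i] := (delta +i* y)%C.

Lemma integrable_expR : nu.-integrable D (EFin \o (fun x => expR (delta * x))).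
Proof.
apply/integrableP; split.
  apply/measurable_EFinP; apply: measurable_funTS.
  apply: (measurableT_comp (@measurable_expR R)); exact: measurable_funM.
under eq_integral do rewrite /= ger0_norm ?expR_ge0//.
exact: le_lt_trans intM (ltry _).
Qed.

Lemma integrable_expR_bounded (g : R -> R) (B : R) :
  measurable_fun setT g -> (forall x, `|g x| <= expR (delta * x) * B) ->
  nu.-integrable D (EFin \o g).
Proof.
move=> mg gB.
apply: (le_integrable mD (g :=
  EFin \o (fun x => expR (delta * x) * B))) => //.
- by apply/measurable_EFinP; exact: measurable_funTS.
- by move=> x _ /=; rewrite lee_fin (le_trans (gB x))// ler_norm.
- apply: eq_integrable (integrableZr mD B integrable_expR) => //.
Qed.

Lemma Rintegral_expR_dist_le (f g : R -> R) (e : R) :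
  nu.-integrable D (EFin \o f) -> nu.-integrable D (EFin \o g) ->
  (forall x, `|f x - g x| <= e * expR (delta * x)) ->
  `|Rintegral nu D f - Rintegral nu D g|
  <= e * fine (\int[nu]_(x in D) (expR (delta * x))%:E).
Proof.
move=> fi gi fg; rewrite -RintegralB//.
have fgi : nu.-integrable D (EFin \o (fun x => f x - g x)).
  by apply: eq_integrable (integrableB mD fi gi).
apply: le_trans (le_normr_Rintegral mD fgi) _.
rewrite -[fine _]/(Rintegral nu D (fun x => expR (delta * x))) -RintegralZl//;
  last exact: integrable_expR.
apply: le_Rintegral => //.
- exact: integrable_norm.
- by apply: eq_integrable (integrableZl mD e integrable_expR).
Qed.

Lemma cexp_cre_le x : `|cre (cexp (eta * x%:C))| <= expR (delta * x).
Proof.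
rewrite /cexp /cre /= mulr0 subr0 normrM ger0_norm ?expR_ge0//.
by rewrite ler_piMr ?expR_ge0// cos_max.
Qed.

Lemma cexp_cim_le x : `|cim (cexp (eta * x%:C))| <= expR (delta * x).
Proof.
rewrite /cexp /cim /= mulr0 subr0 normrM ger0_norm ?expR_ge0//.
by rewrite ler_piMr ?expR_ge0// sin_max.
Qed.

Lemma cexp_cre_measurable : measurable_fun [set: R] (fun x => cre (cexp (eta * x%:C))).
Proof.
rewrite /cexp /cre /=; apply: measurable_funM.
  apply: (measurableT_comp (@measurable_expR R)).
  by apply: measurable_funB; exact: measurable_funM.
apply: (measurableT_comp (continuous_measurable_fun (@continuous_cos R))).
by apply: measurable_funD; exact: measurable_funM.
Qed.

Lemma cexp_cim_measurable : measurable_fun [set: R] (fun x => cim (cexp (eta * x%:C))).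
Proof.
rewrite /cexp /cim /=; apply: measurable_funM.
  apply: (measurableT_comp (@measurable_expR R)).
  by apply: measurable_funB; exact: measurable_funM.
apply: (measurableT_comp (continuous_measurable_fun (@continuous_sin R))).
by apply: measurable_funD; exact: measurable_funM.
Qed.

End ExponentialIntegral.

(** * Lipschitz bound for the nonlocal operator *)

Lemma creM (R : realType) (z w : R[i]) : cre (z * w) = cre z * cre w - cim z * cim w.
Proof. by case: z; case: w. Qed.

Lemma cimM (R : realType) (z w : R[i]) : cim (z * w) = cre z * cim w + cim z * cre w.
Proof. by case: z; case: w. Qed.

Lemma creB (R : realType) (z w : R[i]) : cre (z - w) = cre z - cre w.
Proof. by case: z; case: w. Qed.

Lemma cimB (R : realType) (z w : R[i]) : cim (z - w) = cim z - cim w.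
Proof. by case: z; case: w. Qed.

Lemma crecimM_le (R : realType) (z w : R[i]) (a b c : R) :
  `|cre z| <= a -> `|cim z| <= a -> `|cre w| <= b -> `|cim w| <= c ->
  `|cre (z * w)| <= a * (b + c) /\ `|cim (z * w)| <= a * (b + c).
Proof.
case: z w => [z1 z2] [w1 w2] /= ? ? ? ?; split.
  by rewrite (le_trans (ler_normB _ _))// mulrDr !normrM lerD// ler_pM.
by rewrite addrC (le_trans (ler_normD _ _))// mulrDr !normrM lerD// ler_pM.
Qed.

Section NonlocalStep.
Context {R : realType}.
Variables (lmin h beta delta y : R) (I : nat).
Hypotheses (h0 : 0 < h) (I0 : (0 < I)%N).
Let eta : R[i] := (delta +i* y)%C.

Let integrand (l : R) (V : nat -> R[i]) (x : R) : R[i] :=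
  cexp (eta * x%:C) * pchipC lmin h I V (l + beta * x).

Section Integral.
Variables (m : {measure set R -> \bar R}) (l M : R).
Hypothesis intM :
  (\int[m]_(x in `]0%R, +oo[%classic) (expR (delta * x))%:E <= M%:E)%E.

Lemma integrable_integrand (V : nat -> R[i]) :
  m.-integrable `]0, +oo[%classic (EFin \o (fun x => cre (integrand l V x))) /\
  m.-integrable `]0, +oo[%classic (EFin \o (fun x => cim (integrand l V x))).
Proof.
have [B1 HB1] := pchip_bounded lmin (fun k => cre (V k)) I0 h0.
have [B2 HB2] := pchip_bounded lmin (fun k => cim (V k)) I0 h0.
have ml : measurable_fun [set: R] (fun x => l + beta * x).
  by apply: measurable_funD => //; exact: measurable_funM.
have m1 := measurableT_comp (pchip_measurable lmin h I (fun k => cre (V k))) ml.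
have m2 := measurableT_comp (pchip_measurable lmin h I (fun k => cim (V k))) ml.
have mc := @cexp_cre_measurable R delta y.
have ms := @cexp_cim_measurable R delta y.
have le x := crecimM_le (@cexp_cre_le R delta y x) (@cexp_cim_le R delta y x)
  (HB1 (l + beta * x) : `|cre (pchipC lmin h I V (l + beta * x))| <= B1)
  (HB2 (l + beta * x) : `|cim (pchipC lmin h I V (l + beta * x))| <= B2).
split; apply: (integrable_expR_bounded intM (B := B1 + B2)).
- under eq_fun do rewrite creM.
  by apply: measurable_funB; apply: measurable_funM.
- by move=> x; case: (le x).
- under eq_fun do rewrite cimM.
  by apply: measurable_funD; apply: measurable_funM.
- by move=> x; case: (le x).
Qed.

(** The real and imaginary interpolants each move by at most [3 * e]. A product with the complex
    exponential mixes both, giving [6 * e * expR (delta * x)] per component, and the two components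
    add up to 12. *)
Lemma Cintegral_lipschitz (V W : nat -> R[i]) :
  cnorm (Cintegral m `]0, +oo[%classic (integrand l V)
         - Cintegral m `]0, +oo[%classic (integrand l W))
  <= 12 * normInf I (fun k => V k - W k)
     * fine (\int[m]_(x in `]0%R, +oo[%classic) (expR (delta * x))%:E).
Proof.
have [iV1 iV2] := integrable_integrand V.
have [iW1 iW2] := integrable_integrand W.
set e := normInf I _.
have L1 x : `|pchip lmin h I (fun k => cre (V k)) x
             - pchip lmin h I (fun k => cre (W k)) x| <= 3 * e.
  apply: pchip_lipschitz => // k kI.
  have := cnorm_le_normInf (fun k => V k - W k) kI; apply: le_trans.
  by apply: le_trans (ler_cre_cnorm _); case: (V k); case: (W k).
have L2 x : `|pchip lmin h I (fun k => cim (V k)) x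
             - pchip lmin h I (fun k => cim (W k)) x| <= 3 * e.
  apply: pchip_lipschitz => // k kI.
  have := cnorm_le_normInf (fun k => V k - W k) kI; apply: le_trans.
  by apply: le_trans (ler_cim_cnorm _); case: (V k); case: (W k).
have le x : `|cre (integrand l V x - integrand l W x)| <= 6 * e * expR (delta * x)
    /\ `|cim (integrand l V x - integrand l W x)| <= 6 * e * expR (delta * x).
  have -> : 6 * e * expR (delta * x) = expR (delta * x) * (3 * e + 3 * e) by ring.
  rewrite -mulrBr; apply: crecimM_le.
  - exact: cexp_cre_le.
  - exact: cexp_cim_le.
  - by rewrite creB; exact: L1.
  - by rewrite cimB; exact: L2.
have -> : 12 * e = 6 * e + 6 * e by ring.
rewrite (le_trans (cnorm_le_crecim _))// mulrDl lerD//.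
  apply: (Rintegral_expR_dist_le intM iV1 iW1) => x.
  by rewrite -creB; case: (le x).
apply: (Rintegral_expR_dist_le intM iV2 iW2) => x.
by rewrite -cimB; case: (le x).
Qed.

End Integral.

Variables (nu : R.-pker R ~> R) (M : R).
Hypothesis lmin0 : 0 <= lmin.
Hypothesis intM : forall l, lmin <= l <= lmin + I%:R * h ->
  (\int[nu l]_(x in `]0%R, +oo[%classic) (expR (delta * x))%:E <= M%:E)%E.

Lemma Nexp_lipschitz (V W : nat -> R[i]) i : (i <= I)%N ->
  cnorm (Nexp nu beta eta lmin h I V i - Nexp nu beta eta lmin h I W i)
  <= 12 * Lexp nu lmin h I delta * normInf I (fun k => V k - W k).
Proof.
move=> iI; rewrite /Nexp /=; set l := grid lmin h i; set e := normInf I _.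
have l0 : 0 <= l by rewrite addr_ge0// mulr_ge0// ltW.
have lI : lmin <= l <= lmin + I%:R * h.
  by rewrite lerDl mulr_ge0 ?(ltW h0)//= lerD2l ler_pM2r// ler_nat.
have e0 : 0 <= e by exact: normInf_ge0.
set J := fine (\int[nu l]_(x in `]0%R, +oo[%classic) (expR (delta * x))%:E).
have lL : l * (J + 1) <= Lexp nu lmin h I delta.
  exact: (@le_bigmax _ _ _ 0 (fun i : 'I_I.+1 => grid lmin h i *
    (fine (\int[nu (grid lmin h i)]_(x in `]0%R, +oo[%classic)
      (expR (delta * x))%:E) + 1)) (Ordinal (iI : (i < I.+1)%N))).
have CL : cnorm (Cintegral (nu l) `]0, +oo[%classic (integrand l V)
         - Cintegral (nu l) `]0, +oo[%classic (integrand l W)) <= 12 * e * J.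
  exact: (Cintegral_lipschitz l (intM lI)).
have regroup (a b c d : R[i]) :
  l%:C * (a - c) - l%:C * (b - d) = l%:C * ((a - b) + (d - c)) by ring.
rewrite regroup cnormM cnorm_real ger0_norm//.
have Vi : cnorm (W i - V i) <= e.
  by rewrite -cnormN opprB; exact: (cnorm_le_normInf (fun k => V k - W k) iI).
(* The local term [- V i] costs a single [e], absorbed by the [+ 1] inside [Lexp], which is
   multiplied by 12. *)
apply: (@le_trans _ _ (l * (12 * e * J + e))).
  rewrite ler_wpM2l// (le_trans (cnormD _ _))// lerD//.
have := ler_wpM2r e0 lL; have : 0 <= l * e by rewrite mulr_ge0.
by move=> ? ?; nra.
Qed.

End NonlocalStep.

(** * Error recursion and convergence *)

Theorem mainTheorem3 (R : realType) :
  exists CT : R -> R -> R -> R,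
  forall (T r beta : R) (mu : R -> R) (lmin lmax : R) (nu : R.-pker R ~> R)
    (s0 : R) (I N : nat) (h : R) (delta y : R) (F : R -> R -> R[i])
    (Fs : nat -> nat -> R[i]) (c taubar : R),
    0 < T -> 0 <= r -> 0 <= beta -> 0 <= lmin ->
    (0 < I)%N -> 0 < h -> lmax = lmin + I%:R * h ->
    (0 < N)%N ->
    0 < s0 ->
    (forall l, lmin <= l <= lmax -> nu l `]-oo, 0]%classic = 0%E) ->
    (forall s, 0 <= s < s0 -> exists M : R, forall l, lmin <= l <= lmax ->
        (\int[nu l]_(x in `]0%R, +oo[%classic) (expR (s * x))%:E <= M%:E)%E) ->
    0 < delta < s0 ->
    let eta : R[i] := (delta +i* y)%C in
    let dt := T / N%:R in
    classical_solution T r beta mu nu lmin lmax eta F ->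
    (forall i, (i <= I)%N -> Fs N i = 1) ->
    (forall n, (n < N)%N -> forall i, (i <= I)%N ->
        Aapply mu r dt lmin h I (Fs n) i
        = Fs n.+1 i + dt%:C * Nexp nu beta eta lmin h I (Fs n.+1) i) ->
    c < 1 -> dt * Lexp nu lmin h I delta <= c ->
    (forall n, (n < N)%N ->
        normInf I (tau mu nu r beta eta dt lmin h I F n) <= taubar) ->
    forall n, (n <= N)%N ->
      normInf I (fun i => Fs n i - F (n%:R * dt) (grid lmin h i))
      <= CT T r (Lexp nu lmin h I delta) * taubar.
Proof.
exists (fun T _ L => T * expR (12 * L * T)).
move=> T r beta mu lmin lmax nu s0 I N h delta y F Fs c taubar.
move=> T0 r0 _ lmin0 I0 h0 lmaxE N0 _ _ moment /andP[d0 ds] eta dt.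
case=> [Ft [Fl [_ [_ _ FT]]]] FsN scheme _ _ taule n nN.
subst lmax.
have [M intM] : exists M : R, forall l, lmin <= l <= lmin + I%:R * h ->
    (\int[nu l]_(x in `]0%R, +oo[%classic) (expR (delta * x))%:E <= M%:E)%E.
  by apply: moment; rewrite ltW.
set L := Lexp nu lmin h I delta.
have L0 : 0 <= L by exact: bigmax_ge_id.
have N0R : 0 < N%:R :> R by rewrite ltr0n.
have dt0 : 0 < dt by rewrite divr_gt0.
have dtC : dt%:C != 0 :> R[i].
  by apply/eqP => -[] /eqP; rewrite (gt_eqF dt0).
(* Nonnegativity of [taubar] comes from the residual bound at index 0, available since [0 < N]. *)
have tb0 : 0 <= taubar by apply: le_trans (taule 0%N N0); exact: normInf_ge0.
have NdtT : N%:R * dt = T by rewrite /dt mulrC divfK// gt_eqF.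
pose er n i := Fs n i - F (n%:R * dt) (grid lmin h i).
have erN : normInf I (er N) <= 0.
  apply: normInf_le => // i iI; rewrite /er FsN// NdtT FT ?subrr ?cnorm0//.
  by rewrite lerDl mulr_ge0 ?(ltW h0)//= lerD2l ler_pM2r// ler_nat.
have step k : (k < N)%N ->
    normInf I (er k) <= (1 + dt * (12 * L)) * normInf I (er k.+1) + dt * taubar.
  move=> kN; have e0 := normInf_ge0 I (er k.+1).
  apply: le_trans (normInf_Aapply mu lmin I r0 dt0 h0 (er k)) _.
  apply: normInf_le => [|i iI].
    by rewrite addr_ge0 ?mulr_ge0 ?addr_ge0 ?mulr_ge0// ltW.
  rewrite AapplyB scheme//.
  pose Fn j : R[i] := F (k%:R * dt) (grid lmin h j).
  pose Fn1 j : R[i] := F (k.+1%:R * dt) (grid lmin h j).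
  (* The definition of the residual, multiplied by [dt] and solved for [A F(t_k)]: the exact
     solution satisfies the scheme up to [dt * tau]. *)
  have -> : Aapply mu r dt lmin h I Fn i =
      Fn1 i + dt%:C * Nexp nu beta eta lmin h I Fn1 i
      - dt%:C * tau mu nu r beta eta dt lmin h I F k i.
    have -> : tau mu nu r beta eta dt lmin h I F k i =
      (Fn1 i - Fn i) / dt%:C - (Aapply mu r dt lmin h I Fn i - Fn i) / dt%:C
      + Nexp nu beta eta lmin h I Fn1 i by [].
    by rewrite mulrDr mulrBr !(mulrC dt%:C (_ / _)) !divfK//; ring.
  have -> : Fs k.+1 i + dt%:C * Nexp nu beta eta lmin h I (Fs k.+1) i -
      (Fn1 i + dt%:C * Nexp nu beta eta lmin h I Fn1 i
       - dt%:C * tau mu nu r beta eta dt lmin h I F k i) =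
      er k.+1 i + dt%:C * (Nexp nu beta eta lmin h I (Fs k.+1) i
        - Nexp nu beta eta lmin h I Fn1 i)
      + dt%:C * tau mu nu r beta eta dt lmin h I F k i.
    by rewrite /er -/(Fn1 i); ring.
  rewrite (le_trans (cnormD _ _))// lerD//; last first.
    rewrite cnormM cnorm_real gtr0_norm// ler_pM2l//.
    by apply: le_trans (taule k kN); exact: cnorm_le_normInf.
  rewrite (le_trans (cnormD _ _))// mulrDl mul1r lerD//.
    exact: cnorm_le_normInf.
  rewrite cnormM cnorm_real gtr0_norm// -mulrA ler_pM2l//.
  exact: (Nexp_lipschitz beta y h0 I0 lmin0 intM (Fs k.+1) Fn1 iI).
have q1 : 1 <= 1 + dt * (12 * L) by rewrite lerDl !mulr_ge0// ltW.
have b0 : 0 <= dt * taubar by rewrite mulr_ge0// ltW.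
have := discrete_gronwall q1 b0 erN step (leq_subr n N); rewrite subKn//.
move=> /le_trans; apply.
set m := (N - n)%N.
have mdt : m%:R * dt <= T by rewrite -NdtT ler_pM2r// ler_nat leq_subr.
have m0 : 0 <= m%:R * dt by rewrite mulr_ge0// ltW.
(* Gronwall leaves [m * dt * q ^+ m] with [q = 1 + dt * (12 * L)]. Here [m * dt <= T], and
   [1 + x <= expR x] turns the power into [expR (12 * L * (m * dt))], at most
   [expR (12 * L * T)]. *)
rewrite mulrA mulrAC ler_wpM2r// ler_pM ?exprn_ge0 ?(le_trans _ q1)//.
apply: (@le_trans _ _ (expR (dt * (12 * L)) ^+ m)).
  by rewrite lerXn2r ?nnegrE ?expR_ge0 ?(le_trans _ q1)// expR_ge1Dx.
by rewrite -expRM_natl ler_expR mulrA [leRHS]mulrC ler_wpM2r// mulr_ge0.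
Qed.
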